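(* Let $\delta,\delta'$ satisfy $1>\delta>\delta'>0$. Let $\nu,\kappa_0,\kappa_1:[0,1]\to\mathbb{R}$ be functions of the form $$\nu(\varepsilon)=\underline\nu+\underline\nu'\varepsilon^2+\varepsilon\varphi_1(\varepsilon^2),\qquad \kappa_0(\varepsilon)=\underline{\kappa_0}+\varphi_2(\varepsilon^2),\qquad \kappa_1(\varepsilon)=\underline{\kappa_1}+\varphi_3(\varepsilon^2),$$ where $\underline\nu,\underline\nu',\underline{\kappa_0},\underline{\kappa_1}$ are real constants with $\underline\nu'\ne0$ and $\varphi_1,\varphi_2,\varphi_3:[0,1]\to\mathbb{R}$ are Lipschitz functions with $\varphi_j(0)=0$. Assume that there exists $n\ge2$ such that $$\big|k_2-\underline\nu k_1^2-\underline{\kappa_0}\big|\ge\frac1{k_1^{1+\delta'}}$$ for all $k=(k_1,k_2)\in\mathbb{N}^2$ with $k_1\ge n$. Then there exist $K>0$, $r_0>0$, $N_0\in\mathbb{N}$ and a set $\mathcal{A}\subset[0,1]$ satisfying $$\forall r\in\,]0,r_0],\qquad \frac1r\big|\mathcal{A}\cap[0,r]\big|\ge1-Kr^{\frac{\delta-\delta'}{3+\delta'}},$$ such that, if $\varepsilon^2\in\mathcal{A}$ and $k_1\ge N_0$, then $$\left|k_2-\nu(\varepsilon)k_1^2-\kappa_0(\varepsilon)-\frac{\kappa_1(\varepsilon)}{k_1^2}\right|\ge\frac1{k_1^{2+\delta}}$$ for all $k_2\in\mathbb{N}$.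
   Context: $|\cdot|$ applied to a subset of $\mathbb{R}$ denotes its Lebesgue measure; $\varepsilon\in[0,1]$. *)

(* Defs.v *)
From mathcomp Require Import all_boot all_order all_algebra.
From mathcomp Require Import all_classical all_reals all_analysis.

(* Main.v *)
Require Import Defs.
From mathcomp Require Import all_boot all_order all_algebra.
From mathcomp Require Import all_classical all_reals all_analysis.
From mathcomp Require Import ring lra.
Import Order.TTheory GRing.Theory Num.Theory numFieldNormedType.Exports.
Local Open Scope classical_set_scope.
Local Open Scope ring_scope.

(** Put [t = e ^+ 2].  For fixed [k1, k2] the expression inside the absolute
    value is, near [t = 0], a function of [t] that expands distances by a factor
    of order [k1 ^+ 2], because the perturbation [sqrt t * phi1 t] has a Lipschitz
    constant of order [sqrt t].  So the bad parameters for [(k1, k2)] lie in an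
    interval of length of order [k1 ^- (4 + delta)].  If this interval meets
    [[0, r]], the Diophantine condition at [t = 0] forces [y * k1 >= 1] with [y] of
    order [r `^ (1 / (3 + delta'))], and for each [k1] only [O(k1 ^+ 2 * r + 1)]
    values of [k2] occur.  Summing over [k1 >= 1 / y] gives a bad set of measure
    [O(y `^ (3 + delta))], that is, [O(r `^ ((3 + delta) / (3 + delta')))]. *)

(** * Summation, counting and covering estimates *)

(** Telescoping: [1 / k ^+ 2 <= 2 / k - 2 / (k + 1)] for [k >= 1]. The term [- 2 / n] is kept so
    that the induction closes; at the first [k] with [1 <= y * k] the bound [2 * y - 2 / k] is still
    nonnegative. *)
Lemma sum_tail_inv_sqr (R : realFieldType) (y : R) (n : nat) : 0 <= y ->
  \sum_(0 <= k < n) (if 1 <= y * k%:R then (k%:R ^+ 2)^-1 else 0) <=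
  if 1 <= y * n%:R then 2 * y - 2 / n%:R else 0.
Proof.
move=> y0; elim: n => [|n IH]; first by rewrite big_nil mulr0 ler10.
rewrite big_nat_recr //=.
have n1 : 0 < n.+1%:R :> R by rewrite ltr0n.
have nE : n.+1%:R = n%:R + 1 :> R by rewrite -natr1.
case: ifPn IH => [yn IH|yn IH].
- have yn1 : 1 <= y * n.+1%:R by rewrite nE; nra.
  rewrite yn1.
  have n0 : 0 < n%:R :> R.
    by rewrite lt_neqAle ler0n andbT; apply/eqP => h; move: yn; rewrite -h mulr0 ler10.
  apply: (le_trans (lerD IH (lexx _))).
  rewrite -subr_ge0 nE.
  have -> : 2 * y - 2 / (n%:R + 1) - (2 * y - 2 / n%:R + (n%:R ^+ 2)^-1) =
    (n%:R - 1) / (n%:R ^+ 2 * (n%:R + 1)) :> R by field; lra.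
  by rewrite divr_ge0 ?mulr_ge0 ?sqr_ge0 // ?subr_ge0 ?ler1n -?(ltr0n R) //; lra.
- rewrite addr0; apply: (le_trans IH).
  case: ifPn => // yn1.
  by rewrite subr_ge0 ler_pdivrMr //; lra.
Qed.

(** Indices of nonempty [E j] differ by at most [2 * D], so counting from the smallest one leaves at
    most [2 * D + 1] sets. *)
Lemma measure_bigcup_near d (T : measurableType d) (R : realType)
    (mu : {measure set T -> \bar R}) (E : nat -> set T) (v D w : R) :
  0 <= D -> 0 <= w -> (forall j, measurable (E j)) ->
  (forall j, (mu (E j) <= w%:E)%E) ->
  (forall j, E j !=set0 -> `|j%:R - v| <= D) ->
  (mu (\bigcup_j E j) <= ((2 * D + 1) * w)%:E)%E.
Proof.
move=> D0 w0 mE muE nearE.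
have [[j0 Ej0]|noE] := pselect (exists j, E j !=set0); last first.
  rewrite (_ : \bigcup_j E j = set0) ?measure0 ?lee_fin.
    by rewrite mulr_ge0 // addr_ge0 ?mulr_ge0.
  by rewrite -subset0 => x [j _ Ejx]; apply: noE; exists j, x.
have exE : exists j, `[< E j !=set0 >] by exists j0; apply/asboolP.
case: (ex_minnP exE) => m /asboolP Em minm.
pose n := (Num.trunc (2 * D)).+1.
have DD0 : 0 <= 2 * D by rewrite mulr_ge0.
have /andP[tr1 tr2] := truncn_itv DD0.
have sub : \bigcup_j E j `<=` \big[setU/set0]_(i < n) E (m + i)%N.
  move=> x [j _ Ejx].
  have mj : (m <= j)%N by apply: minm; apply/asboolP; exists x.
  rewrite -(bigcup_mkord n (fun i => E (m + i)%N)).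
  exists (j - m)%N; last by rewrite subnKC.
  have h1 := nearE _ Em; have h2 := nearE j (ex_intro _ x Ejx).
  rewrite /= /n -(ltr_nat R) natrB //.
  apply: le_lt_trans tr2.
  by move: h1 h2; rewrite !ler_norml => /andP[] ? ? /andP[] ? ?; lra.
have mU : measurable (\bigcup_j E j) by apply: bigcup_measurable.
have := content_subadditive mu (fun k _ => mE (m + k)%N) mU sub.
move=> /le_trans; apply.
apply: (@le_trans _ _ (\sum_(i < n) w%:E)%E); first by apply: lee_sum => i _; exact: muE.
rewrite sumEFin lee_fin sumr_const card_ord -[w *+ _]mulr_natl ler_wpM2r //.
by rewrite /n -(natr1 (Num.trunc (2 * D))) lerD2r.
Qed.

(** Replaces a set not known to be measurable by an interval centred at one of its points, or by
    [set0]. The last clause transfers to [I] the bounds known on [B], up to an error [d]. *)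
Lemma cover_of_diameter (R : realType) (B : set R) (d : R) : 0 <= d ->
  (forall s t, B s -> B t -> `|s - t| <= d) ->
  exists I : set R, [/\ measurable I, (lebesgue_measure I <= (2 * d)%:E)%E,
    B `<=` I & forall t, I t -> exists2 s, B s & `|t - s| <= d].
Proof.
move=> d0 diamB; have [[a Ba]|noB] := pselect (B !=set0); last first.
  by exists set0; split => //;
    [rewrite measure0 lee_fin mulr_ge0|move=> s Bs; apply: noB; exists s].
exists [set` `[a - d, a + d]]; split.
- exact: measurable_itv.
- rewrite lebesgue_measure_itv /= lte_fin; case: ifPn => _.
    by rewrite -EFinD lee_fin; lra.
  by rewrite lee_fin mulr_ge0.
- by move=> s Bs; have := diamB _ _ Bs Ba; rewrite /= in_itv /= ler_distl.
- by move=> t; rewrite /= in_itv /= => h; exists a => //; rewrite ler_distl.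
Qed.

(** As [y <= 1 <= y * k], the power [2 + x] of [y * k] dominates both [1] and the first summand. For
    [p = 3 + delta'] the numerator bounds the number of relevant [j] at level [k]. *)
Lemma powR_sum_bound (R : realType) (y k x p : R) :
  0 < y <= 1 -> 1 <= y * k -> 0 <= x -> 2 <= p ->
  (y `^ p * k ^+ 2 + 2) / k `^ (2 + x) <= 3 * y `^ (2 + x).
Proof.
move=> /andP[y0 y1] yk x0 p2.
have k0 : 0 < k by rewrite -(pmulr_rgt0 _ y0); lra.
rewrite ler_pdivrMr ?powR_gt0 // -mulrA -powRM; [|lra..].
have yp : y `^ p <= y ^+ 2.
  by rewrite -powR_mulrn ?(ltW y0)//; apply: ger_powR => //; rewrite y0.
have yk2 : (y * k) ^+ 2 <= (y * k) `^ (2 + x).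
  by rewrite -powR_mulrn; [apply: ler_powR => //; lra|lra].
have yk1 : 1 <= (y * k) `^ (2 + x).
  by rewrite -{1}(powRr0 (y * k)); apply: ler_powR => //; lra.
have : y `^ p * k ^+ 2 <= (y * k) ^+ 2.
  by rewrite exprMn ler_wpM2r ?sqr_ge0.
lra.
Qed.

(** * Measure of the exceptional set *)

(* [v k] is the unperturbed value of [j], and [B k j] the set of parameters at
   which the small divisor of index [(k, j)] violates the lower bound. *)
Lemma exceptional_set (R : realType) (delta delta' : R)
    (N : nat) (B : nat -> nat -> set R) (v : nat -> R) (c E F : R) :
  0 < delta' -> delta' < 1 -> 0 <= delta -> 0 < c -> 0 < E -> 0 <= F ->
  (forall k j s t, (N <= k)%N -> B k j s -> B k j t ->
    `|s - t| <= c / (k%:R ^+ 2 * k%:R `^ (2 + delta))) ->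
  (forall k j s, (N <= k)%N -> B k j s ->
    `|j%:R - v k| <= E * k%:R ^+ 2 * s + F / k%:R ^+ 2) ->
  (forall k j, (N <= k)%N -> 1 / k%:R `^ (1 + delta') <= `|j%:R - v k|) ->
  exists (K : R) (N0 : nat) (U : set R), [/\ 0 < K, (N <= N0)%N, measurable U,
    forall k j, (N0 <= k)%N -> B k j `<=` U &
    forall r, 0 < r <= (2 * E)^-1 ->
      (lebesgue_measure (`[0%R, r] `&` U) <=
        (K * r `^ ((3 + delta) / (3 + delta')))%:E)%E].
Proof.
move=> d'0 d'1 d0 c0 E0 F0 diamB nearB dioph.
(* The extra [E * c] pays for enlarging [B k j] by the radius [rad k], since
   [E * k ^+ 2 * rad k <= E * c / k ^+ 2]. *)
pose F' := F + E * c.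
have F'0 : 0 <= F' by rewrite addr_ge0 // mulr_ge0 // ltW.
(* From [N0] on, [F' / k ^+ 2] is at most half of the Diophantine gap; this is where [delta' < 1]
   enters. *)
pose N0 := maxn (maxn N 1) (Num.bound ((2 * F') `^ (1 - delta')^-1)).
have NN0 : (N <= N0)%N by rewrite !leq_max leqnn.
have N0_gt0 k : (N0 <= k)%N -> 1 <= k%:R :> R.
  by rewrite ler1n; apply: leq_trans; rewrite !leq_max leqnn orbT.
have bigN0 k : (N0 <= k)%N -> F' / k%:R ^+ 2 <= 1 / k%:R `^ (1 + delta') / 2.
  move=> N0k; have k1 := N0_gt0 _ N0k.
  have k0 : 0 < k%:R :> R by lra.
  have h : 2 * F' <= k%:R `^ (1 - delta').
    have := @ge0_ler_powR _ (1 - delta') _ ((2 * F') `^ (1 - delta')^-1) k%:R.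
    rewrite -powRrM mulVf ?powRr1 ?mulr_ge0 //; last by lra.
    apply => //; rewrite ?nnegrE ?powR_ge0 //; first lra.
    apply: (le_trans (ltW (archi_boundP (powR_ge0 _ _)))).
    by rewrite ler_nat (leq_trans _ N0k) // leq_max leqnn orbT.
  have k2E : k%:R ^+ 2 = k%:R `^ (1 + delta') * k%:R `^ (1 - delta').
    rewrite -powRD ?(gt_eqF k0) ?implybT // -powR_mulrn ?ler0n //.
    by congr (_ `^ _); lra.
  rewrite k2E ler_pdivrMr ?mulr_gt0 ?powR_gt0 //.
  rewrite (_ : _ * (_ * _) = k%:R `^ (1 - delta') / 2); first lra.
  by field; rewrite gt_eqF ?powR_gt0.
pose rad (k : nat) : R := c / (k%:R ^+ 2 * k%:R `^ (2 + delta)).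
have rad0 k : 0 <= rad k.
  by rewrite divr_ge0 ?(ltW c0)// mulr_ge0 ?sqr_ge0 ?powR_ge0.
have /choice[I0 HI] : forall k : nat, exists I : nat -> set R, (N <= k)%N ->
  forall j, [/\ measurable (I j), (lebesgue_measure (I j) <= (2 * rad k)%:E)%E,
    B k j `<=` I j & forall t, I j t -> exists2 s, B k j s & `|t - s| <= rad k].
  move=> k; have [Nk|_] := leqP N k; last by exists (fun=> set0).
  have /choice[I HI] := fun j => @cover_of_diameter _ (B k j) (rad k) (rad0 k)
    (fun s t => diamB k j s t Nk).
  by exists I.
(* Emptying the cover below [N0] allows unions over all [k]. *)
pose I k : nat -> set R := if (N0 <= k)%N then I0 k else fun=> set0.
have mI k j : measurable (I k j).
  by rewrite /I; case: ifPn => // N0k; have [] := HI _ (leq_trans NN0 N0k) j.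
have mUI k : measurable (\bigcup_j I k j) by apply: bigcup_measurable.
(* [48 = 6 * 8]: the [6] comes from [b] below, and [8 * y] generously bounds the tail sum of inverse
   squares. The power of [2 * E] comes from [rho = 2 * E * r]. *)
exists (48 * c * (2 * E) `^ ((3 + delta) / (3 + delta'))), N0,
  (\bigcup_k \bigcup_j I k j); split => //.
- by rewrite !mulr_gt0 ?powR_gt0 ?mulr_gt0.
- exact: bigcup_measurable.
- move=> k j N0k s Bs; exists k => //; exists j => //.
  by rewrite /I N0k; have [_ _ + _] := HI _ (leq_trans NN0 N0k) j; apply.
move=> r /andP[r0 rE].
pose rho := 2 * E * r.
have rho0 : 0 < rho by rewrite !mulr_gt0.
have rho1 : rho <= 1.
  by move: rE; rewrite -[X in _ <= X]mul1r ler_pdivlMr ?mulr_gt0 // /rho; lra.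
(* At [k = 1 / y] the drift [E * k ^+ 2 * r] equals half of the Diophantine gap. *)
pose y := rho `^ (3 + delta')^-1.
have y0 : 0 < y by rewrite powR_gt0.
have y1 : y <= 1.
  by rewrite -(powRr0 rho); apply: ger_powR; rewrite ?rho0 ?invr_ge0 //; lra.
have yrho : y `^ (3 + delta') = rho.
  by rewrite -powRrM mulVf ?powRr1 ?(ltW rho0) //; lra.
(* [6 = 2 * 3]: each covering interval has length at most [2 * rad k], and [powR_sum_bound]
   contributes the [3]. *)
pose b (k : nat) : R :=
  6 * c * y `^ (2 + delta) * (if 1 <= y * k%:R then (k%:R ^+ 2)^-1 else 0).
have b0 k : 0 <= b k.
  rewrite mulr_ge0 ?mulr_ge0 ?powR_ge0 ?(ltW c0) //.
  by case: ifP => // _; rewrite invr_ge0 sqr_ge0.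
have slice k :
  (lebesgue_measure (`[0%R, r] `&` \bigcup_j I k j) <= (b k)%:E)%E.
  have [N0k|kN0] := leqP N0 k; last first.
    rewrite /I leqNgt kN0 /= bigcup0 // setI0 measure0 lee_fin; exact: b0.
  have Nk := leq_trans NN0 N0k.
  have k1 := N0_gt0 _ N0k.
  have k0 : 0 < k%:R :> R by lra.
  have k20 : 0 < k%:R ^+ 2 :> R by rewrite exprn_gt0.
  have kp0 : 0 < k%:R `^ (2 + delta) :> R by rewrite powR_gt0.
  have kp1 : 1 <= k%:R `^ (2 + delta) :> R.
    by rewrite -{1}(powRr0 k%:R); apply: ler_powR => //; lra.
  have nearI j : (`[0%R, r] `&` I k j) !=set0 ->
    `|j%:R - v k| <= E * k%:R ^+ 2 * r + F' / k%:R ^+ 2.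
    move=> [t []]; rewrite /= in_itv /= /I N0k => /andP[t0 tr] Ikjt.
    have [_ _ _ /(_ _ Ikjt)[s Bs]] := HI _ Nk j.
    rewrite ler_distl => /andP[ts st].
    have sr : s <= r + rad k by lra.
    apply: (le_trans (nearB _ _ _ Nk Bs)).
    have : E * k%:R ^+ 2 * s <= E * k%:R ^+ 2 * (r + rad k).
      by rewrite ler_wpM2l ?mulr_ge0 ?(ltW E0) ?sqr_ge0.
    have : E * k%:R ^+ 2 * rad k <= E * c / k%:R ^+ 2.
      rewrite /rad (_ : _ * _ = E * c / k%:R `^ (2 + delta)); last first.
        by field; rewrite !gt_eqF.
      rewrite ler_wpM2l ?mulr_ge0 ?(ltW E0) ?(ltW c0) // lef_pV2 ?posrE //.
      by rewrite -powR_mulrn ?(ltW k0) //; apply: ler_powR => //; lra.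
    by rewrite /F' mulrDl mulrDr; lra.
  have Fk := bigN0 _ N0k.
  (* If [y * k < 1], the Diophantine bound leaves no resonance below [r]. *)
  have [yk|yk] := leP 1 (y * k%:R); last first.
    rewrite (_ : _ `&` _ = set0) ?measure0 ?lee_fin; first exact: b0.
    rewrite -subset0 => t [tr [j _ Ikjt]].
    have := nearI j (ex_intro _ t (conj tr Ikjt)).
    have := dioph k j Nk.
    have h : rho * k%:R `^ (3 + delta') < 1.
      rewrite -yrho -powRM ?(ltW y0) ?(ltW k0) //.
      have := @gt0_ltr_powR _ (3 + delta') _ (y * k%:R) 1.
      rewrite powR1; apply; rewrite ?nnegrE ?ler01 //; first lra.
      by rewrite mulr_ge0 // ltW.
    have : E * k%:R ^+ 2 * r < 1 / k%:R `^ (1 + delta') / 2.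
      rewrite [1 / _ / 2]mulrAC mul1r ltr_pdivlMr ?powR_gt0 //.
      move: h; rewrite (_ : 3 + delta' = 2 + (1 + delta')); last by lra.
      rewrite powRD ?(gt_eqF k0) ?implybT // powR_mulrn ?(ltW k0) //.
      by rewrite /rho; lra.
    lra.
  have kd0 : 0 < k%:R `^ (1 + delta') :> R by rewrite powR_gt0.
  have kd1 : 1 <= k%:R `^ (1 + delta') :> R.
    by rewrite -{1}(powRr0 k%:R); apply: ler_powR => //; lra.
  have kdV : 1 / k%:R `^ (1 + delta') <= 1 :> R by rewrite ler_pdivrMr; lra.
  rewrite setI_bigcupr.
  have Er0 : 0 <= E * k%:R ^+ 2 * r by rewrite ltW // !mulr_gt0.
  (* The [2^-1] bounds [F' / k ^+ 2], half of a gap that is at most [1]; hence [2 * D + 1] is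
     [rho * k ^+ 2 + 2]. *)
  apply: (le_trans (@measure_bigcup_near _ _ _ (@lebesgue_measure R)
    (fun j => `[0%R, r] `&` I k j) (v k) (E * k%:R ^+ 2 * r + 2^-1) (2 * rad k)
    _ _ _ _ _)).
  + by rewrite addr_ge0.
  + by rewrite mulr_ge0.
  + by move=> j; apply: measurableI; [exact: measurable_itv|exact: mI].
  + move=> j; apply: (@le_trans _ _ (lebesgue_measure (I k j))).
      apply: le_measure; rewrite ?inE; [|exact: mI|exact: subIsetr];
        apply: measurableI; [exact: measurable_itv|exact: mI].
    by rewrite /I N0k; have [] := HI _ Nk j.
  + by move=> j /nearI; lra.
  rewrite lee_fin /b yk.
  have := @powR_sum_bound _ y k%:R delta (3 + delta').
  rewrite y0 y1 yrho => /(_ isT yk d0) h.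
  have {}h := h ltac:(lra).
  rewrite (_ : (_ + 1) * _ = 2 * c *
    ((rho * k%:R ^+ 2 + 2) / k%:R `^ (2 + delta)) / k%:R ^+ 2); last first.
    by rewrite /rad /rho; field; rewrite !gt_eqF.
  rewrite (_ : 6 * c * y `^ (2 + delta) = 2 * c * (3 * y `^ (2 + delta)));
    last by ring.
  rewrite ler_wpM2r ?invr_ge0 ?(ltW k20) //.
  by rewrite ler_wpM2l // mulr_ge0 ?(ltW c0).
have mJ k : measurable (`[0%R, r] `&` \bigcup_j I k j).
  by apply: measurableI; [exact: measurable_itv|exact: mUI].
rewrite setI_bigcupr.
have := @measure_sigma_subadditive _ _ _ (@lebesgue_measure R) _ _ mJ
  (bigcup_measurable (fun k _ => mJ k)) (@subset_refl _ _).
move=> /le_trans; apply.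
apply: lime_le; first by apply: is_cvg_nneseries => *; exact: measure_ge0.
apply: nearW => n.
apply: (@le_trans _ _ (\sum_(0 <= k < n) (b k)%:E)%E);
  first by apply: lee_sum => k _; exact: slice.
rewrite sumEFin lee_fin -big_distrr /=.
have -> : 48 * c * (2 * E) `^ ((3 + delta) / (3 + delta')) *
    r `^ ((3 + delta) / (3 + delta')) = 6 * c * y `^ (2 + delta) * (8 * y).
  rewrite -mulrA -powRM ?mulr_ge0 ?(ltW E0) ?(ltW r0) // -/rho.
  have -> : rho `^ ((3 + delta) / (3 + delta')) = y `^ (2 + delta) * y.
    rewrite -[X in _ = _ * X]powRr1 ?(ltW y0) // -powRD ?(gt_eqF y0) ?implybT //.
    by rewrite -powRrM; congr (_ `^ _); rewrite mulrC; congr (_ * _); lra.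
  by ring.
rewrite ler_wpM2l ?mulr_ge0 ?powR_ge0 ?(ltW c0) //.
apply: (le_trans (sum_tail_inv_sqr _ _ n (ltW y0))).
have : 0 <= 2 / n%:R :> R by rewrite divr_ge0.
by case: ifP => _; lra.
Qed.

(** * Lipschitz estimates for the perturbation *)

(** The eventual form in [L] lets several functions share one constant. *)
Lemma lipschitz_unit (R : realType) (f : R -> R) :
  [lipschitz f x | x in `[0, 1]] ->
  \forall L \near +oo, forall x y : R, 0 <= x <= 1 -> 0 <= y <= 1 ->
    `|f x - f y| <= L * `|x - y|.
Proof.
rewrite /lipschitz_on; apply: filterS => L Lf x y x01 y01.
by apply: (Lf (x, y)); split; rewrite /= in_itv.
Qed.

(** Let [p <= q] be the roots of [s <= t]. The increment is [q * (f t - f s) + (q - p) * f s]. As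
    [f 0 = 0], [f s] is at most [L * p ^+ 2] in absolute value, and [(q - p) * p <= t - s], so each
    summand carries a factor [Num.sqrt b], small with [b]. *)
Lemma sqrt_mul_lipschitz (R : rcfType) (f : R -> R) (L b s t : R) :
  0 <= L -> f 0 = 0 -> 0 <= b <= 1 ->
  (forall x y : R, 0 <= x <= 1 -> 0 <= y <= 1 -> `|f x - f y| <= L * `|x - y|) ->
  0 <= s <= b -> 0 <= t <= b ->
  `|Num.sqrt s * f s - Num.sqrt t * f t| <= 2 * L * Num.sqrt b * `|s - t|.
Proof.
move=> L0 f0 /andP[b0 b1] Lf; wlog st : s t / s <= t => [H|] sb tb.
  have [/H|/ltW/H] := leP s t; first exact.
  by rewrite [`|s - t|]distrC [`|_ - Num.sqrt t * _|]distrC; apply.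
move: sb tb => /andP[s0 sb] /andP[t0 tb].
have s01 : 0 <= s <= 1 by rewrite s0 (le_trans sb).
have t01 : 0 <= t <= 1 by rewrite t0 (le_trans tb).
have := Lf _ _ s01 t01; have := Lf s 0 s01; rewrite lexx ler01 => /(_ isT).
rewrite f0 !subr0 (ger0_norm s0) [`|s - t|]distrC [`|f s - f t|]distrC.
rewrite [`|_ - Num.sqrt t * _|]distrC (ger0_norm (_ : 0 <= t - s)) ?subr_ge0 //.
have := ler_wsqrtr tb; have := ler_wsqrtr st.
have := sqrtr_ge0 s.
set p := Num.sqrt s; set q := Num.sqrt t; set B := Num.sqrt b => p0 pq qB fs fst.
have sE : s = p ^+ 2 by rewrite sqr_sqrtr.
have tE : t = q ^+ 2 by rewrite sqr_sqrtr.
have -> : q * f t - p * f s = q * (f t - f s) + (q - p) * f s by ring.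
apply: (le_trans (ler_normD _ _)).
rewrite !normrM (ger0_norm (_ : 0 <= q)) ?sqrtr_ge0 //.
rewrite (ger0_norm (_ : 0 <= q - p)) ?subr_ge0 //.
have h1 : q * `|f t - f s| <= B * (L * (t - s)).
  by apply: ler_pM => //; exact: sqrtr_ge0.
have h2 : (q - p) * `|f s| <= (q - p) * (L * s).
  by rewrite ler_wpM2l // subr_ge0.
have h3 : (q - p) * (L * s) <= B * (L * (t - s)).
  rewrite sE tE.
  rewrite (_ : (q - p) * _ = L * ((q - p) * p * p)); last by ring.
  rewrite (_ : B * _ = L * ((q - p) * (q + p) * B)); last by ring.
  rewrite ler_wpM2l // ler_pM ?mulr_ge0 ?subr_ge0 ?ler_wpM2l ?subr_ge0 //.
    by lra.
  exact: le_trans pq qB.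
lra.
Qed.

(** * Small divisors as functions of the squared parameter *)

Theorem proposition2p10 (R : realType) (delta delta' : R)
  (hdelta1 : delta < 1) (hdelta : delta' < delta) (hdelta0 : 0 < delta')
  (nu kappa0 kappa1 : R -> R)
  (nubar nubar' kappa0bar kappa1bar : R)
  (phi1 phi2 phi3 : R -> R)
  (hnu' : nubar' != 0)
  (hphi1 : [lipschitz phi1 x | x in `[0, 1]])
  (hphi2 : [lipschitz phi2 x | x in `[0, 1]])
  (hphi3 : [lipschitz phi3 x | x in `[0, 1]])
  (hphi1_0 : phi1 0 = 0) (hphi2_0 : phi2 0 = 0) (hphi3_0 : phi3 0 = 0)
  (hnu : forall e : R, 0 <= e <= 1 ->
    nu e = nubar + nubar' * e ^+ 2 + e * phi1 (e ^+ 2))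
  (hkappa0 : forall e : R, 0 <= e <= 1 -> kappa0 e = kappa0bar + phi2 (e ^+ 2))
  (hkappa1 : forall e : R, 0 <= e <= 1 -> kappa1 e = kappa1bar + phi3 (e ^+ 2))
  (hdioph : exists n : nat, (2 <= n)%N /\
    forall k1 k2 : nat, (n <= k1)%N ->
      1 / (k1%:R `^ (1 + delta')) <=
      `| k2%:R - nubar * k1%:R ^+ 2 - kappa0bar |) :
  exists (K r0 : R) (N0 : nat) (A : set R),
    [/\ 0 < K,
        0 < r0,
        measurable A /\ A `<=` `[0, 1],
        (forall r : R, 0 < r <= r0 ->
          ((1 - K * r `^ ((delta - delta') / (3 + delta')))%R%:E <=
           (1 / r)%R%:E * lebesgue_measure (A `&` `[0%R, r]))%E)
      & (forall (e : R) (k1 : nat), 0 <= e <= 1 ->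
          A (e ^+ 2) -> (N0 <= k1)%N ->
          forall k2 : nat,
            1 / (k1%:R `^ (2 + delta)) <=
            `| k2%:R - nu e * k1%:R ^+ 2 - kappa0 e
               - kappa1 e / k1%:R ^+ 2 |)].

Proof.
case: hdioph => n [_ dioph].
pose a : R := `|nubar'|.
have a0 : 0 < a by rewrite normr_gt0.
have /filter_ex[L [[[[Lf1 Lf2] Lf3] L1] Lk]] :
    \forall L \near +oo, ((((forall x y : R, 0 <= x <= 1 -> 0 <= y <= 1 ->
      `|phi1 x - phi1 y| <= L * `|x - y|) /\
      (forall x y : R, 0 <= x <= 1 -> 0 <= y <= 1 ->
      `|phi2 x - phi2 y| <= L * `|x - y|)) /\
      (forall x y : R, 0 <= x <= 1 -> 0 <= y <= 1 ->
      `|phi3 x - phi3 y| <= L * `|x - y|)) /\ 1 <= L) /\ `|kappa1bar| <= L.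
  apply: filterI; last exact: nbhs_pinfty_ge (num_real _).
  apply: filterI; last exact: nbhs_pinfty_ge (num_real _).
  apply: filterI; last exact: lipschitz_unit.
  by apply: filterI; exact: lipschitz_unit.
have L0 : 0 < L by apply: lt_le_trans L1.
(* Small enough that the Lipschitz constant of [psi] on [[0, b]] is at most a quarter of the slope
   [a]. *)
pose b := Num.min 1 ((a / (8 * L)) ^+ 2).
have b0 : 0 < b by rewrite lt_min ltr01 exprn_gt0 ?divr_gt0 // mulr_gt0.
have b1 : b <= 1 by rewrite ge_min lexx.
have sqrtb : 2 * L * Num.sqrt b <= a / 4.
  have : Num.sqrt b <= a / (8 * L).
    rewrite -[leRHS]ger0_norm ?divr_ge0 ?mulr_ge0 ?(ltW a0) ?(ltW L0) //.
    by rewrite -sqrtr_sqr ler_wsqrtr // ge_min lexx orbT.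
  by rewrite ler_pdivlMr ?mulr_gt0 //; lra.
(* For [k >= N], [phi2] and [phi3] together cost [2 * L], at most another quarter of
   [a * k ^+ 2]. *)
pose N := maxn n (maxn 1 (Num.bound (8 * L / a))).
have Nn k : (N <= k)%N -> (n <= k)%N.
  by apply: leq_trans; rewrite leq_max leqnn.
have N1 k : (N <= k)%N -> 1 <= k%:R :> R.
  by rewrite ler1n; apply: leq_trans; rewrite !leq_max leqnn orbT.
have NL k : (N <= k)%N -> 8 * L <= a * k%:R ^+ 2.
  move=> Nk; have k1 := N1 _ Nk.
  have : 8 * L / a <= k%:R.
    rewrite (le_trans (ltW (archi_boundP _))) ?divr_ge0 ?mulr_ge0 ?(ltW L0) ?(ltW a0) //.
    by rewrite ler_nat (leq_trans _ Nk) // !leq_max leqnn !orbT.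
  rewrite ler_pdivrMr // => h; apply: (le_trans h).
  by rewrite mulrC ler_pM2l // expr2 ler_peMr //; lra.
pose psi s := Num.sqrt s * phi1 s.
pose g k j s : R := j%:R - (nubar + nubar' * s + psi s) * k%:R ^+ 2
  - (kappa0bar + phi2 s) - (kappa1bar + phi3 s) / k%:R ^+ 2.
pose B (k j : nat) : set R :=
  [set s | 0 <= s <= b /\ `|g k j s| < 1 / k%:R `^ (2 + delta)].
have kp_ge k : (N <= k)%N -> k%:R ^+ 2 <= k%:R `^ (2 + delta) :> R.
  move=> /N1 k1; rewrite -powR_mulrn ?ler0n //; apply: ler_powR => //; lra.
have k2_ge1 k : (N <= k)%N -> 1 <= k%:R ^+ 2 :> R.
  by move=> /N1 k1; rewrite expr_ge1 //; lra.
have invk2 k : (N <= k)%N -> 0 <= ((k%:R : R) ^+ 2)^-1 <= 1.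
  by move=> /k2_ge1 k1; rewrite invr_ge0 invf_le1 ?k1 ?andbT; lra.
(* [4 / a]: two values of [g] below the threshold against an expansion factor [a / 2 * k ^+ 2]. In
   [a + 2 * L], the slope gives [a], and [psi] and [phi2] give [L] each. In [2 * L + 1], [kappa1bar]
   and [phi3] give [L] each, and [g] itself gives [1]. *)
have [||||||k j s t Nk|k j s Nk|k j Nk|K [N0 [U [K0 NN0 mU BU Ur]]]] :=
  @exceptional_set R delta delta' N B (fun k => nubar * k%:R ^+ 2 + kappa0bar)
    (4 / a) (a + 2 * L) (2 * L + 1); try lra.
- by rewrite divr_gt0.
- move=> [/andP[s0 sb] gs] [/andP[t0 tb] gt].
  have s01 : 0 <= s <= 1 by lra.
  have t01 : 0 <= t <= 1 by lra.
  have k20 : 0 < k%:R ^+ 2 :> R by have := k2_ge1 _ Nk; lra.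
  have kp0 : 0 < k%:R `^ (2 + delta) :> R by have := kp_ge _ Nk; lra.
  have h1 := Lf2 _ _ s01 t01; have h2 := Lf3 _ _ s01 t01.
  have h3 : `|psi s - psi t| <= a / 4 * `|s - t|.
    apply: le_trans (ler_wpM2r (normr_ge0 _) sqrtb).
    by apply: sqrt_mul_lipschitz; rewrite ?(ltW L0) ?(ltW b0) ?s0 ?t0.
  have /andP[i0 i1] := invk2 _ Nk.
  have k0 : 0 < k%:R :> R by have := N1 _ Nk; lra.
  have h4 : nubar' * (s - t) * k%:R ^+ 2 = - g k j s + g k j t
      - (psi s - psi t) * k%:R ^+ 2 - (phi2 s - phi2 t)
      - (phi3 s - phi3 t) / k%:R ^+ 2.
    by rewrite /g; field; rewrite gt_eqF.
  have h5 : a * `|s - t| * k%:R ^+ 2 <= `|g k j s| + `|g k j t|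
      + `|psi s - psi t| * k%:R ^+ 2 + `|phi2 s - phi2 t|
      + `|phi3 s - phi3 t| / k%:R ^+ 2.
    rewrite /a -normrM -{1}(ger0_norm (ltW k20)) -normrM h4.
    apply: (le_trans (ler_normB _ _)).
    rewrite [`|_ / _|]normrM normfV (ger0_norm (ltW k20)) lerD2r.
    apply: (le_trans (ler_normB _ _)); rewrite lerD2r.
    apply: (le_trans (ler_normB _ _)).
    rewrite [`|_ * k%:R ^+ 2|]normrM (ger0_norm (ltW k20)) lerD2r.
    by apply: (le_trans (ler_normD _ _)); rewrite normrN.
  have h6 : `|phi3 s - phi3 t| / k%:R ^+ 2 <= L * `|s - t|.
    by apply: le_trans h2; rewrite ler_piMr.
  have h7 : `|psi s - psi t| * k%:R ^+ 2 <= a / 4 * `|s - t| * k%:R ^+ 2.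
    by rewrite ler_wpM2r // ltW.
  have h8 : 8 * L * `|s - t| <= a * k%:R ^+ 2 * `|s - t|.
    by rewrite ler_wpM2r // NL.
  (* Two quarters of the slope are lost, to [psi] and to [phi2] with [phi3]. *)
  have h9 : a / 2 * k%:R ^+ 2 * `|s - t| <= `|g k j s| + `|g k j t|.
    lra.
  move: gs gt; rewrite !ltr_pdivlMr // => gs gt.
  rewrite ler_pdivlMr ?mulr_gt0 // ler_pdivlMr //.
  have := ler_wpM2r (ltW kp0) h9; lra.
- move=> [/andP[s0 sb] gs].
  have s01 : 0 <= s <= 1 by lra.
  have z01 : 0 <= (0 : R) <= 1 by rewrite lexx ler01.
  have k21 := k2_ge1 _ Nk.
  have k20 : 0 < k%:R ^+ 2 :> R by lra.
  have /andP[i0 i1] := invk2 _ Nk.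
  have := Lf1 _ _ s01 z01; have := Lf2 _ _ s01 z01; have := Lf3 _ _ s01 z01.
  rewrite hphi1_0 hphi2_0 hphi3_0 !subr0 (ger0_norm s0) => f3 f2 f1.
  have -> : j%:R - (nubar * k%:R ^+ 2 + kappa0bar) = g k j s
      + (nubar' * s + psi s) * k%:R ^+ 2 + phi2 s
      + (kappa1bar + phi3 s) / k%:R ^+ 2.
    by rewrite /g; field; have := N1 _ Nk; lra.
  have h1 : `|(nubar' * s + psi s) * k%:R ^+ 2| <= (a * s + L * s) * k%:R ^+ 2.
    rewrite normrM (ger0_norm (ltW k20)) ler_wpM2r ?(ltW k20) //.
    apply: (le_trans (ler_normD _ _)); rewrite normrM (ger0_norm s0) lerD2l.
    rewrite normrM (ger0_norm (sqrtr_ge0 _)); apply: le_trans f1.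
    by rewrite ler_piMl // -[leRHS]sqrtr1 ler_wsqrtr //; case/andP: s01.
  have h2 : `|(kappa1bar + phi3 s) / k%:R ^+ 2| <= (L + L) / k%:R ^+ 2.
    rewrite normrM normfV (ger0_norm (ltW k20)) ler_wpM2r //.
    apply: (le_trans (ler_normD _ _)); rewrite lerD //.
    by apply: (le_trans f3); rewrite ler_piMr ?(ltW L0) //; case/andP: s01.
  have h3 : `|g k j s| <= 1 / k%:R ^+ 2.
    by rewrite (le_trans (ltW gs)) // ler_wpM2l // lef_pV2 ?posrE ?kp_ge //;
      have := kp_ge _ Nk; lra.
  have h4 : L * s <= L * s * k%:R ^+ 2.
    by rewrite ler_peMr // mulr_ge0 // ltW.
  have h5 : `|g k j s + (nubar' * s + psi s) * k%:R ^+ 2 + phi2 s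
      + (kappa1bar + phi3 s) / k%:R ^+ 2| <=
      `|g k j s| + `|(nubar' * s + psi s) * k%:R ^+ 2| + `|phi2 s|
      + `|(kappa1bar + phi3 s) / k%:R ^+ 2|.
    by do 3! (apply: (le_trans (ler_normD _ _)); rewrite ?lerD //).
  lra.
- by have := dioph k j (Nn _ Nk); rewrite opprD addrA.
(* [b] keeps the good parameters where [B] is defined; the other bound is the range of validity of
   [Ur]. *)
pose r0 := Num.min b (2 * (a + 2 * L))^-1.
have E0 : 0 < (2 * (a + 2 * L))^-1 by rewrite invr_gt0; lra.
exists K, r0, N0, (`[0%R, r0] `\` U); split => //.
- by rewrite lt_min b0.
- split; first by apply: measurableD => //; exact: measurable_itv.
  move=> x [/=]; rewrite !in_itv /= => /andP[-> xr] _ /=.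
  by apply: (le_trans xr); rewrite ge_min b1.
- move=> r /andP[rp rr0].
  have rE : 0 < r <= (2 * (a + 2 * L))^-1.
    by rewrite rp (le_trans rr0) // ge_min lexx orbT.
  have mr : measurable (`[0%R, r] : set R) by exact: measurable_itv.
  have mA : measurable ((`[0%R, r0] `\` U) `&` `[0%R, r]).
    by apply: measurableI => //; apply: measurableD => //; exact: measurable_itv.
  have mrU : measurable (`[0%R, r] `&` U) by apply: measurableI.
  (* Subadditivity on this cover avoids subtracting extended reals. *)
  have cover : `[0%R, r] `<=` (`[0%R, r0] `\` U) `&` `[0%R, r] `|` `[0%R, r] `&` U.
    move=> x xr; have [Ux|nUx] := pselect (U x); [by right|left; split => //].
    split => //; move: xr; rewrite /= !in_itv /= => /andP[-> xr].
    exact: le_trans xr rr0.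
  have rr : lebesgue_measure (`[0%R, r] : set R) = r%:E.
    by rewrite lebesgue_measure_itv /= lte_fin rp sube0.
  have : (r%:E <= lebesgue_measure ((`[0%R, r0] `\` U) `&` `[0%R, r]) +
      (K * r `^ ((3 + delta) / (3 + delta')))%:E)%E.
    have UrD := leeD2l
      (lebesgue_measure ((`[0%R, r0] `\` U) `&` `[0%R, r])) (Ur r rE).
    apply: le_trans UrD.
    have AU := measureU2 (@lebesgue_measure R) mA mrU.
    rewrite -rr; apply: le_trans AU.
    by apply: le_measure => //; rewrite inE //; exact: measurableU.
  (* The exponent exceeds [1] by exactly the required power, which remains after dividing by [r]. *)
  have rpE : r `^ ((3 + delta) / (3 + delta')) =
      r * r `^ ((delta - delta') / (3 + delta')).
    rewrite -{2}(powRr1 (ltW rp)) -powRD ?(gt_eqF rp) ?implybT //.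
    by congr (_ `^ _); field; lra.
  have := measure_ge0 (@lebesgue_measure R) ((`[0%R, r0] `\` U) `&` `[0%R, r]).
  case: (lebesgue_measure _) => [x|_ _|//].
    rewrite rpE -EFinD -EFinM !lee_fin => _ rx.
    rewrite mul1r [leRHS]mulrC ler_pdivlMr //; lra.
  by rewrite gt0_muley ?leey // lte_fin divr_gt0.
- move=> e k e01 [/=]; rewrite in_itv /= => /andP[_ er0] nU N0k j.
  rewrite leNgt; apply/negP => h; apply: nU; apply: (BU k j N0k).
  have /andP[e0 e1] := e01.
  split; first by rewrite sqr_ge0 (le_trans er0) // ge_min lexx.
  (* Because [e >= 0], the root of [e ^+ 2] is [e], so [g k j (e ^+ 2)] is the original
     expression. *)
  by rewrite /g /psi sqrtr_sqr (ger0_norm e0) -hnu // -hkappa0 // -hkappa1.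
Qed.
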